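(* There is an absolute constant $C>0$ such that the following holds for all $a>0$, $b>0$ and all $g,g_0\in\mathcal P([-a,a])$. Write $d:=\|m_g-m_{g_0}\|_1$. If $h\in(0,b/2)$ and $d\in(0,1)$, then $$W_1(g,g_0)\le C\left(h+\|M_g-M_{g_0}\|_1+b^2\,|\log(h/b)|\,h^{-1}d\right)$$ and $$W_1(g,g_0)\le C\left(h+\bigl(a+b\log(1/d)\bigr)d+b^2\,|\log(h/b)|\,h^{-1}d\right).$$
   Context: $\mathcal P([-a,a])$ is the set of all Borel probability measures on $[-a,a]$. $f_b(z)=\frac{1}{2b}e^{-|z|/b}$ is the Laplace density with scale $b$. For $g\in\mathcal P([-a,a])$, $m_g(x)=(g*f_b)(x)=\int f_b(x-\theta)\,g(\mathrm d\theta)$ is the convolution density and $M_g$ is the cumulative distribution function of $m_g$. $\|\cdot\|_1$ is the $L^1(\mathbb R)$ norm with respect to Lebesgue measure, and $W_1$ is the 1-Wasserstein distance on $\mathbb R$. *)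

(* Defs.v *)
From HB Require Import structures.
From mathcomp Require Import all_boot all_order all_algebra.
From mathcomp Require Import all_classical all_reals all_analysis.

Set Implicit Arguments.
Unset Strict Implicit.
Unset Printing Implicit Defensive.
Import Order.TTheory GRing.Theory Num.Theory.
Import numFieldNormedType.Exports.

Local Open Scope classical_set_scope.
Local Open Scope ring_scope.

(* Borel probability measures on [-a, a], identified with the Borel probability
   measures on the line that give full mass to [-a, a]. *)
Definition prob_itv (R : realType) (a : R) :
    set (probability (measurableTypeR R) R) :=
  [set g | g `[- a, a]%classic = 1%E].

Definition laplace_pdf (R : realType) (b z : R) : R :=
  (2 * b)^-1 * expR (- (`|z| / b)).

Definition mix_pdf (R : realType) (b : R)
    (g : probability (measurableTypeR R) R) (x : R) : R :=
  \int[g]_(t in setT) laplace_pdf b (x - t).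

Definition mix_cdf (R : realType) (b : R)
    (g : probability (measurableTypeR R) R) (x : R) : R :=
  \int[lebesgue_measure]_(t in `]-oo, x]%classic) mix_pdf b g t.

Definition L1norm (R : realType) (f : R -> R) : \bar R :=
  ('N[@lebesgue_measure R]_1 [EFin \o f])%E.

Definition coupling (R : realType) (g g0 : probability (measurableTypeR R) R) :
    set (probability (measurableTypeR R * measurableTypeR R)%type R) :=
  [set p | forall A : set (measurableTypeR R), measurable A ->
     p (A `*` setT) = g A /\ p (setT `*` A) = g0 A].

Definition W1 (R : realType) (g g0 : probability (measurableTypeR R) R) :
    \bar R :=
  ereal_inf [set (\int[p]_z `|z.1 - z.2|%:E)%E | p in coupling g g0].

(* Main.v *)
Require Import Defs.
From HB Require Import structures.
From mathcomp Require Import all_boot all_order all_algebra.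
From mathcomp Require Import all_classical all_reals all_analysis.
From mathcomp Require Import measurable_realfun ring lra.

(** Write [f] for the Laplace density of scale [b], [F] for its distribution
    function, [G] and [G0] for the distribution functions of [g] and [g0], and
    [m], [M] (resp. [m0], [M0]) for the mixture density and distribution
    function of [g] (resp. [g0]).

    On the line, [W1 g g0] is at most the L1 norm of [G - G0]: feeding the same
    uniform variable to the two quantile functions couples [g] and [g0], and
    Tonelli turns the expected distance into the area between the graphs of [G]
    and [G0] ([W1_le_L1norm_prob_cdf]).

    The Laplace kernel is inverted by a differential operator,
    [f - b^2 f'' = delta], hence [G = M - b^2 m'].  The derivative cannot be
    controlled by the L1 norm of [m - m0], but a difference quotient can.
    Replacing [m' x] by [(m (x + h) - m x) / h] costs little, because everything
    is linear in [g] and, for a single atom, the error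
    [1_(0 <= z) - F z + b^2 (f (z + h) - f z) / h] has an integral of order [h]:
    it is of order [h f z] away from the interval [-h <= z < 0] and at most [1]
    on it ([laplace_step_approx]).  Integrating against [g] and [g0] and then
    over the line gives

      [|G - G0|_1 <= 6 h + |M - M0|_1 + 2 b^2 h^-1 d],

    which is [L1norm_prob_cdf_le].

    For the second inequality, [|M - M0| <= d] pointwise, while outside [-a, a]
    both distribution functions have exponentially small tails.  Cutting the
    line at [T = a + b ln (1 / d)], where the tails have decreased to size [d],
    bounds [|M - M0|_1] by [2 T d + 2 b d] ([L1norm_mix_cdf_le]).

    Finally [h < b / 2] gives [1 / 2 <= |ln (h / b)|], so that up to a constant
    the last term of the claim dominates both [b^2 h^-1 d] and [b d]
    ([log_term_ge]). *)

Set Implicit Arguments.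
Unset Strict Implicit.
Unset Printing Implicit Defensive.
Import Order.TTheory GRing.Theory Num.Theory.
Import numFieldNormedType.Exports.

Local Open Scope classical_set_scope.
Local Open Scope ring_scope.

(** * The Laplace kernel *)

Definition laplace_cdf (R : realType) (b z : R) : R :=
  if z < 0 then expR (z / b) / 2 else 1 - expR (- (z / b)) / 2.

(** The distribution function of the unit mass at the origin, real valued so that
    it can be convolved like the Laplace distribution function. *)
Definition step (R : realType) (z : R) : R := (0 <= z)%R%:R.

Section laplace.
Context {R : realType}.
Implicit Types b h z : R.

(** From [1 - e <= expR (- e)], since [1 <= (1 + e + 2 e^2) (1 - e)] for
    [0 <= e <= 1 / 2]. *)
Lemma expR_le_quadratic (e : R) : 0 <= e -> e <= 2^-1 ->
  expR e <= 1 + e + 2 * e ^+ 2.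
Proof.
move=> e0 e1.
have h1 : 1 - e <= expR (- e) by have := expR_ge1Dx (- e).
have h2 : expR e * expR (- e) = 1 by rewrite -expRD subrr expR0.
have h3 : 0 < expR e := expR_gt0 e.
have h4 : expR e * (1 - e) <= 1 by rewrite -[leRHS]h2 ler_pM2l.
rewrite -(@ler_pM2r _ (1 - e)); last by lra.
apply: (le_trans h4).
have : e * e * e <= 2^-1 * e * e.
  by rewrite ler_wpM2r// ler_wpM2r.
have : 0 <= e * e by apply: mulr_ge0.
rewrite !expr2; lra.
Qed.

Lemma laplace_pdf_ge0 b z : 0 < b -> 0 <= laplace_pdf b z.
Proof. by move=> b0; rewrite mulr_ge0 ?expR_ge0// invr_ge0 mulr_ge0// ltW. Qed.

Lemma laplace_pdf_le b z : 0 < b -> laplace_pdf b z <= (2 * b)^-1.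
Proof.
move=> b0; rewrite /laplace_pdf ler_piMr ?invr_ge0 ?mulr_ge0 ?(ltW b0)//.
by rewrite expR_le1 oppr_le0 divr_ge0// ltW.
Qed.

Lemma laplace_pdf_nonneg b z : 0 <= z ->
  laplace_pdf b z = (2 * b)^-1 * expR (- (z / b)).
Proof. by move=> z0; rewrite /laplace_pdf ger0_norm. Qed.

Lemma laplace_pdf_nonpos b z : z <= 0 ->
  laplace_pdf b z = (2 * b)^-1 * expR (z / b).
Proof. by move=> z0; rewrite /laplace_pdf ler0_norm// mulNr opprK. Qed.

Lemma laplace_pdfN b z : laplace_pdf b (- z) = laplace_pdf b z.
Proof. by rewrite /laplace_pdf normrN. Qed.

Lemma laplace_cdf_ge0 b z : 0 < b -> 0 <= laplace_cdf b z.
Proof.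
move=> b0; rewrite /laplace_cdf; case: ltP => z0.
  by rewrite divr_ge0 ?expR_ge0.
have : expR (- (z / b)) <= 1.
  by rewrite expR_le1 oppr_le0 divr_ge0// ltW.
lra.
Qed.

Lemma laplace_cdf_le1 b z : 0 < b -> laplace_cdf b z <= 1.
Proof.
move=> b0; rewrite /laplace_cdf; case: ltP => z0; last first.
  have := expR_ge0 (- (z / b)); lra.
have : expR (z / b) <= 1.
  by rewrite expR_le1 pmulr_lle0 ?invr_gt0// ltW.
lra.
Qed.

(** The inversion formula for one atom.  For [z <> 0] one has
    [b^2 f' z = F z - 1_(0 <= z)], as [f - b^2 f'' = delta]; so the left-hand side
    is [b^2] times the error made by a difference quotient of [f].  Where [f] is
    smooth on [z, z + h] this is a second order Taylor term.  On the remaining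
    interval, [-h <= z < 0], both terms are of order [1], and the increment of
    [step] on the right-hand side is precisely the indicator of that interval. *)
Lemma laplace_step_approx b h z : 0 < b -> 0 < h -> h <= b / 2 ->
  `| step z - laplace_cdf b z
     + b ^+ 2 / h * (laplace_pdf b (z + h) - laplace_pdf b z) |
  <= 2 * h * laplace_pdf b z + (step (z + h) - step z).
Proof.
move=> b0 h0 hb.
have bn0 : b != 0 by rewrite gt_eqF.
have hn0 : h != 0 by rewrite gt_eqF.
(* Only the ratio e = h / b matters, and e <= 1 / 2. *)
set e := h / b.
have e0 : 0 < e by rewrite divr_gt0.
have e1 : e <= 2^-1 by rewrite ler_pdivrMr// mulrC.
have he : h = e * b by rewrite /e divfK.
have hbe : h / b = e by [].
clearbody e.
have EA : 1 - e <= expR (- e) by have := expR_ge1Dx (- e).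
have EB : expR (- e) <= 1 - e + e ^+ 2.
  have : expR (- e) * expR e = 1 by rewrite -expRD addrC subrr expR0.
  have := expR_ge1Dx e; have := expR_ge0 (- e).
  have := expR_ge0 e.
  move=> p1 p2 p3 p4.
  have p5 : expR (- e) * (1 + e) <= 1 by rewrite -[leRHS]p4 ler_wpM2l.
  rewrite -(@ler_pM2r _ (1 + e)); last by lra.
  apply: (le_trans p5).
  have : 0 <= e * e * e by rewrite !mulr_ge0// ltW.
  rewrite !expr2; lra.
have EC := expR_ge1Dx e.
have ED := expR_le_quadratic (ltW e0) e1.
rewrite /step; case: (leP 0 z) => z0 /=.
- have -> : 0 <= z + h by lra.
  rewrite /laplace_cdf ltNge z0 /= !laplace_pdf_nonneg//; last by lra.
  rewrite (mulrDl z h) hbe (opprD (z / b)) expRD.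
  set u := expR (- (z / b)).
  have u0 : 0 < u := expR_gt0 _.
  have ue : 0 <= u / (2 * e).
    by apply: divr_ge0; [exact: ltW|apply: mulr_ge0 => //; exact: ltW].
  set v := expR (- e) in EA EB *.
  have -> : 1 - (1 - u / 2) +
      b ^+ 2 / h * ((2 * b)^-1 * (u * v) - (2 * b)^-1 * u)
      = u / (2 * e) * (e - 1 + v).
    by rewrite he; field; rewrite gt_eqF.
  rewrite subrr addr0 normrM (ger0_norm ue).
  rewrite ger0_norm; last by lra.
  have -> : 2 * h * ((2 * b)^-1 * u) = u / (2 * e) * (2 * e ^+ 2).
    by rewrite he; field; rewrite bn0 gt_eqF.
  apply: ler_wpM2l => //.
  have := sqr_ge0 e; lra.
- rewrite /laplace_cdf z0 sub0r subr0.
  case: (leP 0 (z + h)) => zh /=.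
  + rewrite mulr1n; apply: ler_wpDl.
      apply: mulr_ge0; last exact: laplace_pdf_ge0.
      by apply: mulr_ge0 => //; exact: ltW.
    rewrite laplace_pdf_nonneg// laplace_pdf_nonpos; last exact: ltW.
    set s := - (z / b).
    have -> : z / b = - s by rewrite /s opprK.
    have -> : (z + h) / b = e - s by rewrite /s (mulrDl z h) hbe; ring.
    have s0 : 0 < s by rewrite /s oppr_gt0 pmulr_llt0// invr_gt0.
    have s1 : s <= e.
      by rewrite /s -mulNr ler_pdivrMr// -he; lra.
    have -> : - (expR (- s) / 2) +
       b ^+ 2 / h * ((2 * b)^-1 * expR (- (e - s)) - (2 * b)^-1 * expR (- s))
      = (2 * e)^-1 * ((expR (- (e - s)) - 1) + (1 - expR (- s)))
        - expR (- s) / 2.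
      by rewrite he; field; rewrite bn0 gt_eqF.
    have q1 : expR (- s) <= 1 by rewrite expR_le1; lra.
    have q2 : expR (- (e - s)) <= 1 by rewrite expR_le1; lra.
    have q3 : 1 - s <= expR (- s) by have := expR_ge1Dx (- s).
    have q4 : 1 - (e - s) <= expR (- (e - s)) by have := expR_ge1Dx (- (e - s)).
    have q5 : 0 < (2 * e)^-1 by rewrite invr_gt0 mulr_gt0.
    have q6 : (2 * e)^-1 * e = 2^-1 by field; rewrite gt_eqF.
    have q7 := expR_ge0 (- s).
    rewrite ler_norml; apply/andP; split.
      have : (2 * e)^-1 * (- e) <=
         (2 * e)^-1 * (expR (- (e - s)) - 1 + (1 - expR (- s))).
        by rewrite ler_wpM2l ?(ltW q5)//; lra.
      lra.
    have : (2 * e)^-1 * (expR (- (e - s)) - 1 + (1 - expR (- s))) <=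
        (2 * e)^-1 * e.
      by rewrite ler_wpM2l ?(ltW q5)//; lra.
    lra.
  + rewrite !laplace_pdf_nonpos ?(ltW zh) ?(ltW z0)//.
    rewrite (mulrDl z h) hbe expRD addr0.
    set u := expR (z / b).
    have u0 : 0 < u := expR_gt0 _.
    have ue : 0 <= u / (2 * e).
      by apply: divr_ge0; [exact: ltW|apply: mulr_ge0 => //; exact: ltW].
    set v := expR e in EC ED *.
    have -> : - (u / 2) +
        b ^+ 2 / h * ((2 * b)^-1 * (u * v) - (2 * b)^-1 * u)
        = u / (2 * e) * (v - 1 - e).
      by rewrite he; field; rewrite bn0 gt_eqF.
    rewrite normrM (ger0_norm ue).
    rewrite ger0_norm; last by lra.
    have -> : 2 * h * ((2 * b)^-1 * u) = u / (2 * e) * (2 * e ^+ 2).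
      by rewrite he; field; rewrite bn0 gt_eqF.
    apply: ler_wpM2l => //.
    have := sqr_ge0 e; lra.
Qed.

End laplace.

(** * Convolution of a probability measure with a bounded kernel *)

Definition bounded_measurable (R : realType) (phi : R -> R) :=
  measurable_fun setT phi /\ exists K, forall z, `|phi z| <= K.

Section bounded_measurable.
Context {R : realType}.
Implicit Types (phi psi : R -> R) (c x z : R).

Lemma bounded_measurableB phi psi : bounded_measurable phi ->
  bounded_measurable psi -> bounded_measurable (fun z => phi z - psi z).
Proof.
move=> [mphi [K phiK]] [mpsi [L psiL]]; split; first exact: measurable_funB.
exists (K + L) => z; rewrite (le_trans (ler_normB _ _))//.
exact: lerD.
Qed.

Lemma bounded_measurableD phi psi : bounded_measurable phi ->
  bounded_measurable psi -> bounded_measurable (fun z => phi z + psi z).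
Proof.
move=> [mphi [K phiK]] [mpsi [L psiL]]; split; first exact: measurable_funD.
exists (K + L) => z; rewrite (le_trans (ler_normD _ _))//.
exact: lerD.
Qed.

Lemma bounded_measurableZ c phi : bounded_measurable phi ->
  bounded_measurable (fun z => c * phi z).
Proof.
move=> [mphi [K phiK]]; split; first exact: measurable_funM.
by exists (`|c| * K) => z; rewrite normrM ler_wpM2l.
Qed.

Lemma bounded_measurable_shift c phi : bounded_measurable phi ->
  bounded_measurable (fun z => phi (z + c)).
Proof.
move=> [mphi [K phiK]]; split; last by exists K.
by apply: (@measurableT_comp _ _ _ _ _ _ phi) => //; exact: measurable_funD.
Qed.

Lemma bounded_measurable_norm phi : bounded_measurable phi ->
  bounded_measurable (fun z => `|phi z|).
Proof.
move=> [mphi [K phiK]]; split; last by exists K => z; rewrite normr_id.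
exact: measurableT_comp.
Qed.

End bounded_measurable.

(** With this definition [mix_pdf b g] is the convolution of [g] with the Laplace
    density, the mixture distribution function is its convolution with the Laplace
    distribution function ([mix_cdfE]), and the distribution function of [g] is
    its convolution with [step] ([prob_cdfE]).  Pointwise inequalities between
    kernels thus become inequalities between these functions. *)
Definition convolution (R : realType) (g : probability (measurableTypeR R) R)
    (phi : R -> R) (x : R) : R :=
  \int[g]_(t in setT) phi (x - t).

Section convolution.
Context {R : realType} (g : probability (measurableTypeR R) R).
Local Notation mu := (@lebesgue_measure R).
Local Notation conv := (convolution g).
Implicit Types (phi psi : R -> R) (c x : R).

Lemma bounded_measurable_integrable phi : bounded_measurable phi ->
  g.-integrable setT (EFin \o phi).
Proof.
move=> [mphi [K phiK]]; apply: measurable_bounded_integrable => //.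
  by rewrite -ge0_fin_numE// fin_num_measure.
exists K; split; first exact: num_real.
by move=> M KM x _ /=; rewrite (le_trans (phiK x))// ltW.
Qed.

Lemma integrable_shift phi x : bounded_measurable phi ->
  g.-integrable setT (EFin \o (fun t => phi (x - t))).
Proof.
move=> [mphi [K phiK]]; apply: bounded_measurable_integrable; split.
  by apply: (@measurableT_comp _ _ _ _ _ _ phi) => //; exact: measurable_funB.
by exists K => z.
Qed.

Lemma convolutionB phi psi x : bounded_measurable phi ->
  bounded_measurable psi ->
  conv (fun z => phi z - psi z) x = conv phi x - conv psi x.
Proof. by move=> bphi bpsi; rewrite [LHS]RintegralB//; exact: integrable_shift. Qed.

Lemma convolutionD phi psi x : bounded_measurable phi ->
  bounded_measurable psi ->
  conv (fun z => phi z + psi z) x = conv phi x + conv psi x.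
Proof. by move=> bphi bpsi; rewrite [LHS]RintegralD//; exact: integrable_shift. Qed.

Lemma convolutionZ c phi x : bounded_measurable phi ->
  conv (fun z => c * phi z) x = c * conv phi x.
Proof. by move=> bphi; rewrite [LHS]RintegralZl//; exact: integrable_shift. Qed.

Lemma convolution_shift c phi x :
  conv (fun z => phi (z + c)) x = conv phi (x + c).
Proof. by apply: eq_Rintegral => t _; rewrite addrAC. Qed.

Lemma convolution_ge0 phi x : (forall z, 0 <= phi z) -> 0 <= conv phi x.
Proof. by move=> phi0; apply: Rintegral_ge0. Qed.

Lemma le_convolution phi psi x : bounded_measurable phi ->
  bounded_measurable psi -> (forall z, phi z <= psi z) ->
  conv phi x <= conv psi x.
Proof.
by move=> bphi bpsi le_phi_psi; apply: le_Rintegral => //; exact: integrable_shift.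
Qed.

Lemma norm_convolution_le phi x : bounded_measurable phi ->
  `|conv phi x| <= conv (fun z => `|phi z|) x.
Proof. by move=> bphi; apply: le_normr_Rintegral => //; exact: integrable_shift. Qed.

Lemma EFin_convolution phi x : bounded_measurable phi ->
  (conv phi x)%:E = (\int[g]_t (phi (x - t))%:E)%E.
Proof.
move=> bphi; rewrite /convolution /Rintegral fineK//.
by apply: integrable_fin_num => //; exact: integrable_shift.
Qed.

Lemma measurable_fun_sub2 phi : measurable_fun setT phi ->
  measurable_fun setT (fun p : measurableTypeR R * measurableTypeR R =>
    phi (p.1 - p.2)).
Proof.
move=> mphi; apply: (@measurableT_comp _ _ _ _ _ _ phi) => //.
by apply: measurable_funB; [exact: measurable_fst|exact: measurable_snd].
Qed.

Lemma measurable_convolution phi : bounded_measurable phi ->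
  (forall z, 0 <= phi z) -> measurable_fun setT (conv phi).
Proof.
move=> bphi phi0; apply/measurable_EFinP.
rewrite (_ : EFin \o _ = fun x => (\int[g]_t (phi (x - t))%:E)%E); last first.
  by apply/funext => x; exact: EFin_convolution.
apply: (@measurable_fun_fubini_tonelli_F _ _ (measurableTypeR R)
  (measurableTypeR R) R g (fun p => (phi (p.1 - p.2))%:E)) => //.
  by apply/measurable_EFinP; apply: measurable_fun_sub2; case: bphi.
by move=> p /=; rewrite lee_fin.
Qed.

(** Tonelli; the indicator of [D] is moved into the integrand so that both
    integrations run over the whole line. *)
Lemma integral_convolution phi (D : set R) : measurable D ->
  bounded_measurable phi -> (forall z, 0 <= phi z) ->
  (\int[mu]_(x in D) (conv phi x)%:E =
   \int[g]_t \int[mu]_(x in D) (phi (x - t))%:E)%E.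
Proof.
move=> mD bphi phi0.
under eq_integral do rewrite (EFin_convolution _ bphi).
transitivity (\int[mu]_x \int[g]_t (phi (x - t) * \1_D x)%:E)%E.
  rewrite [LHS]integral_mkcond; apply: eq_integral => x _.
  rewrite patchE indicE; case: ifPn => xD.
    by under [RHS]eq_integral do rewrite mulr1.
  by under [RHS]eq_integral do rewrite mulr0; rewrite integral0.
have := @fubini_tonelli _ _ (measurableTypeR R) (measurableTypeR R) R mu g
  (fun p => (phi (p.1 - p.2) * \1_D p.1)%:E).
rewrite /= => ->; last 2 first.
- apply/measurable_EFinP; apply: measurable_funM.
    by apply: measurable_fun_sub2; case: bphi.
  apply: (@measurableT_comp _ _ _ _ _ _ (\1_D : R -> R)); last first.
    exact: measurable_fst.
  exact: measurable_indic.
- by move=> p; rewrite lee_fin mulr_ge0.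
apply: eq_integral => t _; rewrite [RHS]integral_mkcond.
apply: eq_integral => x _; rewrite patchE indicE.
by case: ifPn => _; rewrite ?mulr1 ?mulr0.
Qed.

Lemma integral_convolutionT phi (c : \bar R) : bounded_measurable phi ->
  (forall z, 0 <= phi z) ->
  (forall t, \int[mu]_x (phi (x - t))%:E = c)%E ->
  (\int[mu]_x (conv phi x)%:E = c)%E.
Proof.
move=> bphi phi0 phic; rewrite (integral_convolution measurableT bphi)//.
under eq_integral do rewrite phic.
by rewrite integral_cst//= probability_setT mule1.
Qed.

End convolution.

(** * Integrals of the Laplace density *)

Section laplace_integrals.
Context {R : realType}.
Local Notation mu := (@lebesgue_measure R).
Implicit Types (b t x : R).

Lemma measurable_laplace_pdf b : measurable_fun setT (laplace_pdf b : R -> R).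
Proof.
apply: measurable_funM => //.
apply: (@measurableT_comp _ _ _ _ _ _ (@expR R)); first exact: measurable_expR.
by apply: measurable_funN; apply: measurable_funM => //; exact: normr_measurable.
Qed.

Lemma measurable_laplace_cdf b : measurable_fun setT (laplace_cdf b : R -> R).
Proof.
apply: measurable_fun_ifT => //.
- exact: measurable_fun_ltr.
- apply: measurable_funM => //.
  apply: (@measurableT_comp _ _ _ _ _ _ (@expR R)); first exact: measurable_expR.
  exact: measurable_funM.
- apply: measurable_funB => //; apply: measurable_funM => //.
  apply: (@measurableT_comp _ _ _ _ _ _ (@expR R)); first exact: measurable_expR.
  by apply: measurable_funN; exact: measurable_funM.
Qed.

Lemma measurable_step : measurable_fun setT (@step R).
Proof.
rewrite (_ : step (R := R) = \1_(`[0, +oo[%classic)); first exact: measurable_indic.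
by apply/funext => z; rewrite indicE mem_setE in_itv /= andbT.
Qed.

Lemma bounded_measurable_laplace_pdf b : 0 < b ->
  bounded_measurable (laplace_pdf b).
Proof.
move=> b0; split; first exact: measurable_laplace_pdf.
by exists (2 * b)^-1 => z; rewrite ger0_norm ?laplace_pdf_le// laplace_pdf_ge0.
Qed.

Lemma bounded_measurable_laplace_cdf b : 0 < b ->
  bounded_measurable (laplace_cdf b).
Proof.
move=> b0; split; first exact: measurable_laplace_cdf.
by exists 1 => z; rewrite ger0_norm ?laplace_cdf_le1// laplace_cdf_ge0.
Qed.

Lemma step_ge0 (z : R) : 0 <= step z.
Proof. by rewrite /step. Qed.

Lemma bounded_measurable_step : bounded_measurable (@step R).
Proof.
split; first exact: measurable_step.
by exists 1 => z; rewrite ger0_norm ?step_ge0// /step; case: (0 <= z).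
Qed.

Lemma continuous_laplace_pdf b t : continuous (fun y : R => laplace_pdf b (y - t)).
Proof.
move=> y; apply: cvgM; first exact: cvg_cst.
apply: continuous_comp; last exact: continuous_expR.
apply: cvgN; apply: cvgM; last exact: cvg_cst.
by apply: cvg_norm; apply: cvgB; [exact: cvg_id|exact: cvg_cst].
Qed.

(** To the right of its centre [t] the density is smooth, so the fundamental
    theorem of calculus applies.  The left tail follows by reflection, and the
    two tails at [t] give the total mass; the kink at [t] never has to be
    differentiated. *)
Lemma integral_laplace_pdf_right b t x : 0 < b -> t <= x ->
  (\int[mu]_(y in `[x, +oo[) (laplace_pdf b (y - t))%:E =
   (expR (- ((x - t) / b)) / 2)%:E)%E.
Proof.
move=> b0 tx.
have bn0 : b != 0 by rewrite gt_eqF.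
pose F (y : R) : R := - (expR (- ((y - t) / b)) / 2).
have dF y : is_derive y (1 : R) F ((2 * b)^-1 * expR (- ((y - t) / b))).
  rewrite /F; apply: is_derive_eq.
  by rewrite /GRing.scale /=; field.
rewrite (@ge0_continuous_FTC2y _ _ F _ 0).
- by rewrite sub0e /F EFinN oppeK.
- by move=> y _; exact: laplace_pdf_ge0.
- by apply: continuous_subspaceT; exact: continuous_laplace_pdf.
- rewrite -oppr0; apply: cvgN; rewrite -(mul0r 2^-1); apply: cvgM; last exact: cvg_cst.
  rewrite (_ : (fun y => expR (- ((y - t) / b))) =
               (fun z => expR (- z)) \o (fun y => (y - t) / b))//.
  apply: (@cvg_comp _ _ _ _ _ _ (pinfty_nbhs R)); last exact: cvgr_expR.
  apply: gt0_cvgMly; first by rewrite invr_gt0.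
  exact: cvg_addrr.
- by move=> y _; exact: (@ex_derive _ _ _ _ _ _ _ (dF y)).
- apply: cvg_at_right_filter.
  have := dF x => /@ex_derive /derivable1_diffP /differentiable_continuous; exact.
- move=> y; rewrite in_itv /= andbT => xy.
  rewrite derive1E derive_val laplace_pdf_nonneg//.
  by rewrite subr_ge0 (le_trans tx)// ltW.
Qed.

Lemma integral_laplace_pdf_left b t x : 0 < b -> x <= t ->
  (\int[mu]_(y in `]-oo, x]) (laplace_pdf b (y - t))%:E =
   (expR ((x - t) / b) / 2)%:E)%E.
Proof.
move=> b0 xt.
rewrite -{1}(opprK x) ge0_integration_by_substitutionNy; last 2 first.
- by apply: continuous_subspaceT; exact: continuous_laplace_pdf.
- by move=> y _; exact: laplace_pdf_ge0.
under eq_integral => y _.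
  rewrite /= -laplace_pdfN (_ : - (- y - t) = y - (- t)); last by ring.
  over.
rewrite integral_laplace_pdf_right//; last by rewrite lerN2.
by congr (expR _ / 2)%:E; field; rewrite gt_eqF.
Qed.

Lemma integral_laplace_pdf_split b t x :
  0 < b ->
  (\int[mu]_y (laplace_pdf b (y - t))%:E =
   \int[mu]_(y in `]-oo, x]) (laplace_pdf b (y - t))%:E +
   \int[mu]_(y in `[x, +oo[) (laplace_pdf b (y - t))%:E)%E.
Proof.
move=> b0.
have mf D : measurable_fun (D : set R) (fun y => (laplace_pdf b (y - t))%:E).
  apply: measurable_funTS; apply/measurable_EFinP.
  by apply: continuous_measurable_fun; exact: continuous_laplace_pdf.
rewrite -(itv_setU_setT false x) ge0_integral_setU//=.
- by rewrite integral_itv_obnd_cbnd//; exact: mf.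
- exact: mf.
- by move=> y _; rewrite lee_fin laplace_pdf_ge0.
- exact: disjoint_rays.
Qed.

Lemma integral_laplace_pdf b t : 0 < b ->
  (\int[mu]_y (laplace_pdf b (y - t))%:E = 1)%E.
Proof.
move=> b0; rewrite (integral_laplace_pdf_split t t b0).
rewrite integral_laplace_pdf_left// integral_laplace_pdf_right//.
by rewrite subrr mul0r oppr0 expR0 -EFinD; congr EFin; field.
Qed.

Lemma integral_laplace_pdf_cdf b t x : 0 < b ->
  (\int[mu]_(y in `]-oo, x]) (laplace_pdf b (y - t))%:E =
   (laplace_cdf b (x - t))%:E)%E.
Proof.
move=> b0; rewrite /laplace_cdf; case: ltP => xt.
  by rewrite integral_laplace_pdf_left//; move: xt; rewrite subr_lt0 => /ltW.
have := integral_laplace_pdf_split t x b0.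
rewrite integral_laplace_pdf// integral_laplace_pdf_right; [|by []|by move: xt; rewrite subr_ge0].
by move=> H; rewrite EFinB H addeK.
Qed.

End laplace_integrals.

(** * Distribution functions *)

Definition prob_cdf (R : realType) (g : probability (measurableTypeR R) R)
  (x : R) : R := fine (g `]-oo, x]%classic).

Section prob_cdf_theory.
Context {R : realType}.
Implicit Types g P Q : probability (measurableTypeR R) R.

(* The identity, as a random variable with law g: the general theory of the
   distribution functions of random variables then applies to prob_cdf g. *)
Let idTR : measurableTypeR R -> R := idfun.

#[local] HB.instance Definition _ :=
  @isMeasurableFun.Build _ _ _ _ idTR (@measurable_id _ _ setT).

Lemma EFin_prob_cdf g x : (prob_cdf g x)%:E = g `]-oo, x]%classic.
Proof. by rewrite fineK// fin_num_measure. Qed.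

Lemma prob_cdf_cdf g x : (prob_cdf g x)%:E = cdf (idTR : {RV g >-> R}) x.
Proof. exact: EFin_prob_cdf. Qed.

Lemma prob_cdf_nondecreasing g x y : x <= y -> prob_cdf g x <= prob_cdf g y.
Proof.
by move=> xy; rewrite -lee_fin !prob_cdf_cdf cdf_nondecreasing.
Qed.

Lemma measurable_prob_cdf g : measurable_fun setT (prob_cdf g).
Proof. by apply: nondecreasing_measurable => // x y; exact: prob_cdf_nondecreasing. Qed.

Lemma prob_cdf_ge0 g x : 0 <= prob_cdf g x.
Proof. by rewrite -lee_fin EFin_prob_cdf. Qed.

Lemma prob_cdf_le1 g x : prob_cdf g x <= 1.
Proof. by rewrite -lee_fin EFin_prob_cdf probability_le1. Qed.

Lemma prob_cdf_right_continuous g : right_continuous (prob_cdf g).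
Proof.
move=> x; apply: fine_cvg; rewrite fineK ?fin_num_measure//.
exact: (@cdf_right_continuous _ _ _ g (idTR : {RV g >-> R})).
Qed.

Lemma cvg_prob_cdfy g : prob_cdf g x @[x --> +oo] --> (1 : R).
Proof.
apply: fine_cvg; exact: (@cvg_cdfy1 _ _ _ g (idTR : {RV g >-> R})).
Qed.

Lemma cvg_prob_cdfNy g : prob_cdf g x @[x --> -oo] --> (0 : R).
Proof.
apply: fine_cvg; exact: (@cvg_cdfNy0 _ _ _ g (idTR : {RV g >-> R})).
Qed.

Lemma eq_prob_cdf P Q : prob_cdf P =1 prob_cdf Q ->
  forall A, measurable A -> P A = Q A.
Proof.
move=> PQ; apply: (@measure_unique _ R (measurableTypeR R) (@ocitv R)
  (fun n => `](- n%:R), n%:R]%classic) _ _ _ _ P Q) => //.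
- exact: ocitvI.
- by move=> n; exact: is_ocitv.
- rewrite -subTset => x _; exists (Num.truncn `|x|).+1 => //=.
  have := truncnS_gt `|x|; rewrite in_itv/= => xn.
  rewrite (le_trans (ler_norm x) (ltW xn)) andbT ltrNl.
  by rewrite (le_lt_trans _ xn)// -normrN ler_norm.
- move=> _ [[a b] _ <-] /=.
  have [ab|ba] := leP a b; last first.
    by rewrite set_itv_ge ?measure0// bnd_simp -leNgt ltW.
  have E (T : probability (measurableTypeR R) R) :
      T `]a, b]%classic = ((prob_cdf T b)%:E - (prob_cdf T a)%:E)%E.
    rewrite !EFin_prob_cdf.
    have -> : `]a, b]%classic = `]-oo, b] `\` `]-oo, a].
      by rewrite -[RHS]setCK setCD setCitvl setUC -[LHS]setCK setCitv.
    rewrite measureD//= ?setIidr//.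
      exact: subset_itvl.
    by rewrite -ge0_fin_numE// fin_num_measure.
  by rewrite !E !PQ.
- by move=> n; rewrite -ge0_fin_numE// fin_num_measure.
Qed.

End prob_cdf_theory.

(** * The quantile coupling *)

Definition quantile (R : realType) (g : probability (measurableTypeR R) R)
  (s : R) : R := inf [set x | s <= prob_cdf g x].

Lemma L1normE (R : realType) (f : R -> R) :
  L1norm f = (\int[@lebesgue_measure R]_x `|f x|%:E)%E.
Proof. by rewrite /L1norm Lnorm1. Qed.

Section quantile.
Context {R : realType}.
Implicit Types (g : probability (measurableTypeR R) R) (s x : R).

(** The Galois connection between quantile and distribution function; right
    continuity makes the infimum defining the quantile a minimum. *)
Lemma quantile_le g s x : 0 < s < 1 -> (quantile g s <= x) = (s <= prob_cdf g x).
Proof.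
move=> /andP[s0 s1]; set A := [set x | s <= prob_cdf g x].
have Alb : has_lbound A.
  have : \forall y \near -oo, prob_cdf g y < s.
    exact: (cvgr_lt _ (cvg_prob_cdfNy g)).
  move=> [M [_ HM]]; exists (M - 1) => y /= sy.
  rewrite leNgt; apply/negP => yM.
  have /HM : y < M by lra.
  by rewrite /= ltNge sy.
have A0 : A !=set0.
  have : \forall y \near +oo, s < prob_cdf g y.
    exact: (cvgr_gt _ (cvg_prob_cdfy g)).
  move=> [M [_ HM]]; exists (M + 1); apply: ltW; apply: HM; lra.
have Ainf : has_inf A by [].
apply/idP/idP => [qx|sx]; last exact: ge_inf.
rewrite (le_trans _ (prob_cdf_nondecreasing g qx))//.
apply: (cvgr_to_ge (prob_cdf_right_continuous (g := g) (x := quantile g s))).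
near=> y.
have yq : 0 < y - quantile g s by rewrite subr_gt0; near: y; exact: nbhs_right_gt.
have [e /= Ae] := inf_adherent yq Ainf.
rewrite addrCA subrr addr0 => ey.
by rewrite (le_trans Ae)// prob_cdf_nondecreasing// ltW.
Unshelve. all: by end_near. Qed.

(** The quantile is meaningful for [0 < s < 1] only: outside, the set whose infimum
    is taken may be empty or unbounded below.  It is set to a constant there, which
    makes it measurable on the whole line and does not change its law under the
    uniform measure. *)
Definition unit_quantile g (s : measurableTypeR R) : measurableTypeR R :=
  (quantile g \_ `]0, 1[) s.

Lemma measurable_unit_quantile g :
  measurable_fun setT (unit_quantile g).
Proof.
rewrite /unit_quantile.
apply/measurable_restrict => //; rewrite setTI => mD.
apply: (measurability _ (RGenOInfty.measurableE R)) => //.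
move=> _ [_ [x ->] <-].
rewrite (_ : _ `&` _ = `]0, 1[ `&` `]prob_cdf g x, +oo[); first exact: measurableI.
apply/seteqP; split => s /=; rewrite !in_itv/= !andbT => -[s01 H]; split => //.
  by move: H; rewrite !ltNge quantile_le.
by move: H; rewrite !ltNge quantile_le.
Qed.

Definition quantile_pair g g0 (s : measurableTypeR R) :
    measurableTypeR R * measurableTypeR R :=
  (unit_quantile g s, unit_quantile g0 s).

Lemma measurable_quantile_pair g g0 : measurable_fun setT (quantile_pair g g0).
Proof. by apply: measurable_fun_pair; exact: measurable_unit_quantile. Qed.

HB.instance Definition _ g g0 := @isMeasurableFun.Build _ _ _ _
  (quantile_pair g g0) (measurable_quantile_pair g g0).

HB.instance Definition _ g := @isMeasurableFun.Build _ _
  (measurableTypeR R) (measurableTypeR R)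
  (unit_quantile g) (measurable_unit_quantile g).

Local Notation unif := (uniform_prob (@ltr01 R)).
Local Notation mu := (@lebesgue_measure R).

Lemma integral_unif (f : R -> \bar R) : measurable_fun setT f ->
  (forall s, 0 <= f s)%E ->
  (\int[unif]_s f s = \int[mu]_(s in `]0%R, 1%R[) f s)%E.
Proof.
move=> mf f0; rewrite integral_uniform// subr0 invr1 mul1e.
by rewrite integral_itv_bndoo//; exact: measurable_funTS.
Qed.

(** Inverse transform sampling: the uniform measure of [s <= prob_cdf g x] is
    [prob_cdf g x]. *)
Lemma prob_cdf_quantile g :
  prob_cdf (distribution unif (unit_quantile g)) = prob_cdf g.
Proof.
apply/funext => x; apply/EFin_inj; rewrite EFin_prob_cdf.
set B := unit_quantile g @^-1` `]-oo, x]%classic.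
rewrite -[LHS]/(unif B).
have mB : measurable B by rewrite -(setTI B); exact: measurable_unit_quantile.
have -> : unif B = (\int[unif]_s (\1_B s)%:E)%E by rewrite integral_indic// setIT.
rewrite integral_unif//; last by apply/measurable_EFinP; exact: measurable_indic.
rewrite integral_indic//=.
have BE s : (B `&` `]0, 1[) s <-> 0 < s < 1 /\ s <= prob_cdf g x.
  rewrite /B /= !in_itv /= /unit_quantile patchE mem_setE in_itv/=.
  split => [[H1 s01]|[s01 H1]]; split => //; last by rewrite s01 quantile_le.
  by move: H1; rewrite s01 quantile_le.
have c1 := prob_cdf_le1 g x; have c0 := prob_cdf_ge0 g x.
have [lt1|ge1] := ltP (prob_cdf g x) 1.
  have -> : B `&` `]0, 1[ = `]0, prob_cdf g x]%classic.
    apply/seteqP; split => s.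
      by move=> /BE[/andP[s0 _] sc]; rewrite /= in_itv/= s0.
    rewrite /= in_itv/= => /andP[s0 sc]; apply/BE; split => //.
    by rewrite s0 (le_lt_trans sc).
  rewrite lebesgue_measure_itv/= lte_fin.
  case: ltP => H; first by rewrite -EFinB subr0.
  by congr EFin; apply/eqP; rewrite eq_le c0 H.
have c1E : prob_cdf g x = 1 by apply/eqP; rewrite eq_le c1 ge1.
have -> : B `&` `]0, 1[ = `]0, 1[%classic.
  apply/seteqP; split => s; first by move=> [].
  rewrite /= in_itv/= => s01; apply/BE; split => //.
  by rewrite c1E ltW//; case/andP: s01.
by rewrite lebesgue_measure_itv/= lte_fin ltr01 -EFinB subr0 c1E.
Qed.

Lemma quantile_distribution g A : measurable A ->
  distribution unif (unit_quantile g) A = g A.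
Proof. by move=> mA; apply: eq_prob_cdf => // x; rewrite prob_cdf_quantile. Qed.

Lemma coupling_quantile g g0 :
  coupling g g0 (distribution unif (quantile_pair g g0)).
Proof.
move=> A mA; split.
  rewrite -(quantile_distribution g mA) /distribution /pushforward.
  by congr (unif _); apply/seteqP; split => s /=; [case|].
rewrite -(quantile_distribution g0 mA) /distribution /pushforward.
by congr (unif _); apply/seteqP; split => s /=; [case|].
Qed.

Lemma integral_step_left (p q : R) :
  (\int[mu]_x `|step (x - p) - step (x - q)|%R%:E = `|p - q|%:E)%E.
Proof.
wlog pq : p q / p <= q.
  move=> H; have [pq|/ltW qp] := leP p q; first exact: H.
  rewrite distrC -(H q p qp); apply: eq_integral => x _.
  by rewrite distrC.
rewrite (eq_integral (fun x : measurableTypeR R => (\1_(`[p, q[%classic) x)%:E)).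
  rewrite integral_indic//= setIT lebesgue_measure_itv/= lte_fin -EFinB.
  rewrite distrC ger0_norm ?subr_ge0//; case: ltP => // qp; congr EFin; lra.
move=> x _; rewrite indicE mem_setE in_itv/= /step !subr_ge0 (ltNge x).
case: (leP p x) => px /=; case: (leP q x) => qx /=.
- by rewrite subrr normr0.
- by rewrite subr0 normr1.
- by exfalso; lra.
- by rewrite subrr normr0.
Qed.

Lemma integral_step_right (p q : R) :
  (\int[mu]_s `|step (p - s) - step (q - s)|%R%:E = `|p - q|%:E)%E.
Proof.
wlog pq : p q / q <= p.
  move=> H; have [pq|/ltW qp] := leP q p; first exact: H.
  rewrite distrC -(H q p qp); apply: eq_integral => x _.
  by rewrite distrC.
rewrite (eq_integral (fun x : measurableTypeR R => (\1_(`]q, p]%classic) x)%:E)).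
  rewrite integral_indic//= setIT lebesgue_measure_itv/= lte_fin -EFinB.
  rewrite ger0_norm ?subr_ge0//; case: ltP => // qp; congr EFin; lra.
move=> x _; rewrite indicE mem_setE in_itv/= /step !subr_ge0 (ltNge q).
case: (leP x p) => px /=; case: (leP x q) => qx /=.
- by rewrite subrr normr0.
- by rewrite subr0 normr1.
- by exfalso; lra.
- by rewrite subrr normr0.
Qed.

(** Tonelli.  The left-hand side is the area, inside the strip [0 < s < 1], of the
    region between the graphs of [F] and [F0], measured along the lines of
    constant [s]. *)
Lemma integral_step_area (F F0 : R -> R) :
  measurable_fun setT F -> measurable_fun setT F0 ->
  (\int[mu]_(s in `]0%R, 1%R[) \int[mu]_x
     `|step (F x - s) - step (F0 x - s)|%R%:E <=
   \int[mu]_x `|F x - F0 x|%R%:E)%E.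
Proof.
move=> mF mF0.
pose f (z : measurableTypeR R * measurableTypeR R) : \bar R :=
  `|step (F z.2 - z.1) - step (F0 z.2 - z.1)|%:E.
have mf : measurable_fun setT f.
  have mst (F1 : R -> R) : measurable_fun setT F1 -> measurable_fun setT
      (fun z : measurableTypeR R * measurableTypeR R => step (F1 z.2 - z.1)).
    move=> mF1.
    apply: (@measurableT_comp _ _ _ _ _ _ (@step R)); first exact: measurable_step.
    apply: measurable_funB; last exact: measurable_fst.
    by apply: (@measurableT_comp _ _ _ _ _ _ F1) => //; exact: measurable_snd.
  apply/measurable_EFinP; apply: measurableT_comp => //.
  by apply: measurable_funB; exact: mst.
have f0 z : (0 <= f z)%E by rewrite lee_fin.
apply: (@le_trans _ _ (\int[mu]_s \int[mu]_x f (s, x))%E).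
  apply: ge0_subset_integral => //.
  - exact: (@measurable_fun_fubini_tonelli_F _ _ (measurableTypeR R)
      (measurableTypeR R) R mu f mf f0).
  - by move=> s _; apply: integral_ge0 => x _; rewrite lee_fin.
rewrite (fubini_tonelli f mf f0) le_eqVlt; apply/orP; left; apply/eqP.
by apply: eq_integral => x _; rewrite -integral_step_right.
Qed.

(** The distance between the two quantiles at [s] is the length of the set of
    those [x] that exactly one of them does not exceed.  By the Galois connection
    this is the section at height [s] of the region between the graphs of the two
    distribution functions. *)
Lemma W1_le_L1norm_prob_cdf g g0 :
  (W1 g g0 <= L1norm (fun x => (prob_cdf g x - prob_cdf g0 x)%R))%E.
Proof.
apply: (@le_trans _ _ (\int[distribution unif (quantile_pair g g0)]_z
    `|z.1 - z.2|%:E)%E).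
  apply: ereal_inf_lbound => /=; exists (distribution unif (quantile_pair g g0)) => //.
  exact: coupling_quantile.
have mabs : measurable_fun setT
    (fun z : measurableTypeR R * measurableTypeR R => (`|z.1 - z.2|%R)%:E).
  apply/measurable_EFinP; apply: measurableT_comp => //.
  by apply: measurable_funB; [exact: measurable_fst|exact: measurable_snd].
rewrite ge0_integral_distribution//.
rewrite integral_unif//; last 2 first.
- by apply: (measurableT_comp mabs); exact: measurable_quantile_pair.
- by move=> s; rewrite lee_fin.
rewrite L1normE.
apply: le_trans (integral_step_area (measurable_prob_cdf g) (measurable_prob_cdf g0)).
rewrite le_eqVlt; apply/orP; left; apply/eqP.
apply: eq_integral => s; rewrite mem_setE in_itv/= => s01.
rewrite /unit_quantile !patchE mem_setE in_itv/= s01.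
rewrite -integral_step_left; apply: eq_integral => x _.
by rewrite /step !subr_ge0 !quantile_le.
Qed.

End quantile.

(** * Translation invariance of the Lebesgue measure *)

Section translation.
Context {R : realType}.
Local Notation mu := (@lebesgue_measure R).

Lemma lebesgue_measure_translation (c : R) (A : set R) : measurable A ->
  pushforward mu ((fun x => x + c) : _ -> measurableTypeR R) A = mu A.
Proof.
move=> mA; apply/esym; apply: lebesgue_measure_unique => //=.
  exact: measurable_funD.
move=> _ _ [[a b]] _ <-.
rewrite /pushforward.
rewrite (_ : _ @^-1` _ = `]a - c, b - c]%classic); last first.
  by apply/seteqP; split => x /=; rewrite !in_itv/= ltrBlDr lerBrDr.
rewrite !lebesgue_measure_itv/= !lte_fin ltrD2r -!EFinB.
by congr (if _ then _%:E else _); ring.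
Qed.

Lemma ge0_integral_translation (c : R) (f : R -> \bar R) :
  measurable_fun setT f -> (forall x, 0 <= f x)%E ->
  (\int[mu]_x f (x + c)%R = \int[mu]_x f x)%E.
Proof.
move=> mf f0.
have mT : measurable_fun setT ((fun x => x + c) : measurableTypeR R -> measurableTypeR R).
  exact: measurable_funD.
rewrite -[in LHS](preimage_setT (fun x : R => x + c)).
rewrite -(@ge0_integral_pushforward _ _ _ _ _ _ mT mu setT f)//.
apply: eq_measure_integral => /= A mA _.
exact: lebesgue_measure_translation.
Qed.

End translation.

(** * Bounding the distance between distribution functions by that of mixtures *)

Section smoothing.
Context {R : realType}.
Local Notation mu := (@lebesgue_measure R).
Implicit Types (g : probability (measurableTypeR R) R) (b h x : R).

Lemma mix_pdfE b g : mix_pdf b g = convolution g (laplace_pdf b).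
Proof. by []. Qed.

Lemma mix_cdfE b g : 0 < b -> mix_cdf b g = convolution g (laplace_cdf b).
Proof.
move=> b0; apply/funext => x.
rewrite /mix_cdf /Rintegral mix_pdfE integral_convolution//; last 2 first.
- exact: bounded_measurable_laplace_pdf.
- by move=> z; exact: laplace_pdf_ge0.
under eq_integral do rewrite integral_laplace_pdf_cdf//.
by [].
Qed.

Lemma prob_cdfE g : prob_cdf g = convolution g (step (R := R)).
Proof.
apply/funext => x; rewrite /convolution /Rintegral; congr fine.
rewrite (eq_integral (fun t : measurableTypeR R => (\1_(`]-oo, x]%classic) t)%:E)).
  by rewrite integral_indic// setIT.
by move=> t _; rewrite indicE mem_setE in_itv/= /step subr_ge0.
Qed.

Lemma measurable_mix_pdf b g : 0 < b -> measurable_fun setT (mix_pdf b g).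
Proof.
move=> b0; rewrite mix_pdfE; apply: measurable_convolution.
- exact: bounded_measurable_laplace_pdf.
- by move=> z; exact: laplace_pdf_ge0.
Qed.

Lemma mix_pdf_ge0 b g x : 0 < b -> 0 <= mix_pdf b g x.
Proof. by move=> b0; apply: convolution_ge0 => z; exact: laplace_pdf_ge0. Qed.

Lemma measurable_mix_cdf b g : 0 < b -> measurable_fun setT (mix_cdf b g).
Proof.
move=> b0; rewrite mix_cdfE//; apply: measurable_convolution.
- exact: bounded_measurable_laplace_cdf.
- by move=> z; exact: laplace_cdf_ge0.
Qed.

Lemma integral_mix_pdf b g : 0 < b -> (\int[mu]_x (mix_pdf b g x)%:E = 1)%E.
Proof.
move=> b0; rewrite mix_pdfE; apply: integral_convolutionT.
- exact: bounded_measurable_laplace_pdf.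
- by move=> z; exact: laplace_pdf_ge0.
- by move=> t; exact: integral_laplace_pdf.
Qed.

Lemma le_step (z h : R) : 0 <= h -> step z <= step (z + h).
Proof.
move=> h0; rewrite /step; case: (leP 0 z) => [z0|_]; last by [].
by rewrite addr_ge0.
Qed.

(** The increment is the convolution of [g] with the indicator of [-h, 0[, whose
    integral is [h]. *)
Lemma integral_prob_cdf_increment g h : 0 <= h ->
  (\int[mu]_x (prob_cdf g (x + h) - prob_cdf g x)%R%:E = h%:E)%E.
Proof.
move=> h0; rewrite prob_cdfE.
have bs := @bounded_measurable_step R.
have bsh := bounded_measurable_shift h bs.
under eq_integral do rewrite -convolution_shift -convolutionB//.
apply: integral_convolutionT.
- exact: bounded_measurableB.
- by move=> z; rewrite subr_ge0 le_step.
move=> t.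
rewrite (eq_integral (fun x : measurableTypeR R =>
    (\1_(`[t - h, t[%classic) x)%:E)); last first.
  move=> x _; rewrite indicE mem_setE in_itv/= /step.
  have -> : (t - h <= x) = (0 <= x - t + h) by apply/idP/idP; lra.
  have -> : (x < t) = ~~ (0 <= x - t) by rewrite subr_ge0 ltNge.
  case: (leP 0 (x - t)) => xt /=.
    by rewrite addr_ge0// subrr.
  by rewrite andbT subr0.
rewrite integral_indic//= setIT lebesgue_measure_itv/= lte_fin.
rewrite -EFinB opprB addrCA subrr addr0.
case: ltP => // h1; congr EFin; lra.
Qed.

(** [laplace_step_approx] at [x - t], integrated against [g (dt)]. *)
Lemma prob_cdf_mix_cdf_approx b h g x : 0 < b -> 0 < h -> h <= b / 2 ->
  `| prob_cdf g x - mix_cdf b g x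
     + b ^+ 2 / h * (mix_pdf b g (x + h) - mix_pdf b g x) |
  <= 2 * h * mix_pdf b g x + (prob_cdf g (x + h) - prob_cdf g x).
Proof.
move=> b0 h0 hb.
have bs := @bounded_measurable_step R.
have bsh := bounded_measurable_shift h bs.
have bp := bounded_measurable_laplace_pdf b0.
have bph := bounded_measurable_shift h bp.
have bc := bounded_measurable_laplace_cdf b0.
have b1 := bounded_measurableB bs bc.
have b2 := bounded_measurableB bph bp.
have b3 := bounded_measurableZ (b ^+ 2 / h) b2.
have b4 := bounded_measurableD b1 b3.
have b5 := bounded_measurableZ (2 * h) bp.
have b6 := bounded_measurableB bsh bs.
rewrite mix_cdfE// mix_pdfE prob_cdfE.
rewrite -!convolution_shift -!convolutionB// -!convolutionZ// -!convolutionD//.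
apply: (le_trans (norm_convolution_le _ _ b4)).
apply: le_convolution; first exact: bounded_measurable_norm.
  exact: bounded_measurableD.
by move=> z; exact: laplace_step_approx.
Qed.

(** Each of [g] and [g0] contributes an error whose integral is
    [2 h + h], from the total mass of the mixture and the increment of the
    distribution function; the difference quotient of [m - m0] costs twice its
    norm, by translation invariance. *)
Lemma L1norm_prob_cdf_le b h g g0 : 0 < b -> 0 < h -> h <= b / 2 ->
  (L1norm (fun x => (prob_cdf g x - prob_cdf g0 x)%R) <=
   (6 * h)%:E + L1norm (fun x => (mix_cdf b g x - mix_cdf b g0 x)%R) +
   (2 * (b ^+ 2 / h))%:E *
     L1norm (fun x => (mix_pdf b g x - mix_pdf b g0 x)%R))%E.
Proof.
move=> b0 h0 hb; rewrite !L1normE.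
set c := b ^+ 2 / h.
have c0 : 0 <= c by rewrite divr_ge0 ?sqr_ge0// ltW.
set S := fun x => prob_cdf g x - prob_cdf g0 x.
set U := fun x => mix_cdf b g x - mix_cdf b g0 x.
set u := fun x => mix_pdf b g x - mix_pdf b g0 x.
(* The right-hand side of prob_cdf_mix_cdf_approx. *)
pose r (g : probability (measurableTypeR R) R) x :=
  2 * h * mix_pdf b g x + (prob_cdf g (x + h) - prob_cdf g x).
have mS : measurable_fun setT S by apply: measurable_funB; exact: measurable_prob_cdf.
have mU : measurable_fun setT U by apply: measurable_funB; exact: measurable_mix_cdf.
have mu_ : measurable_fun setT u by apply: measurable_funB; exact: measurable_mix_pdf.
have muh : measurable_fun setT (fun x => u (x + h)).
  by apply: (@measurableT_comp _ _ _ _ _ _ u) => //; exact: measurable_funD.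
have mabs (f : R -> R) : measurable_fun setT f ->
    measurable_fun setT (fun x : R => `|f x|%:E).
  by move=> mf; apply/measurable_EFinP; exact: measurableT_comp.
have mGh g1 : measurable_fun setT (fun x => prob_cdf g1 (x + h)).
  apply: (@measurableT_comp _ _ _ _ _ _ (prob_cdf g1)).
    exact: measurable_prob_cdf.
  exact: measurable_funD.
have mi g1 : measurable_fun setT (fun x : R => (prob_cdf g1 (x + h) - prob_cdf g1 x)%:E).
  apply/measurable_EFinP; apply: measurable_funB => //.
  exact: measurable_prob_cdf.
have mp g1 : measurable_fun setT (fun x : R => (2 * h * mix_pdf b g1 x)%:E).
  by apply/measurable_EFinP; apply: measurable_funM => //; exact: measurable_mix_pdf.
have i0 g1 x : (0 <= (prob_cdf g1 (x + h) - prob_cdf g1 x)%:E)%E.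
  by rewrite lee_fin subr_ge0 prob_cdf_nondecreasing// lerDl ltW.
have hh0 : 0 <= 2 * h by rewrite mulr_ge0// ltW.
have p0 g1 x : (0 <= (2 * h * mix_pdf b g1 x)%:E)%E.
  by rewrite lee_fin; apply: mulr_ge0 => //; exact: mix_pdf_ge0.
have r0 g1 x : (0 <= (r g1 x)%:E)%E by rewrite EFinD adde_ge0.
have mr g1 : measurable_fun setT (fun x : R => (r g1 x)%:E).
  by under eq_fun do rewrite EFinD; exact: emeasurable_funD.
have ir g1 : (\int[mu]_x (r g1 x)%:E = (3 * h)%:E)%E.
  under eq_integral do rewrite EFinD.
  rewrite ge0_integralD//; [|exact: mp|exact: mi].
  rewrite integral_prob_cdf_increment ?(ltW h0)//.
  under eq_integral do rewrite EFinM.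
  rewrite ge0_integralZl//.
  - by rewrite integral_mix_pdf// mule1 -EFinD; congr EFin; ring.
  - by apply/measurable_EFinP; exact: measurable_mix_pdf.
  - by move=> x _; rewrite lee_fin mix_pdf_ge0.
have ptwise x : (`|S x| <= `|U x| + c * (`|u (x + h)| + `|u x|) + (r g x + r g0 x)).
  have := prob_cdf_mix_cdf_approx g x b0 h0 hb.
  have := prob_cdf_mix_cdf_approx g0 x b0 h0 hb.
  rewrite -/c -/(r g x) -/(r g0 x).
  set A0 := (X in `|X| <= _ -> _); set A := (X in _ -> `|X| <= _ -> _) => HA0 HA.
  have -> : S x = U x - c * (u (x + h) - u x) + (A - A0).
    have rearrange (y1 y0 k1 k0 v1 v0 w1 w0 : R) : y1 - y0 =
        (k1 - k0) - c * ((v1 - v0) - (w1 - w0)) +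
        ((y1 - k1 + c * (v1 - w1)) - (y0 - k0 + c * (v0 - w0))) by ring.
    exact: rearrange.
  rewrite (le_trans (ler_normD _ _))// lerD//; last first.
    by rewrite (le_trans (ler_normB _ _))// lerD.
  rewrite (le_trans (ler_normB _ _))// lerD2l normrM (ger0_norm c0) ler_wpM2l//.
  exact: ler_normB.
apply: (@le_trans _ _ (\int[mu]_x (`|U x|%:E + c%:E * (`|u (x + h)%R|%:E + `|u x|%:E) +
    ((r g x)%:E + (r g0 x)%:E)))%E).
  apply: ge0_le_integral => //.
  - exact: mabs.
  - apply: emeasurable_funD; last by apply: emeasurable_funD; exact: mr.
    apply: emeasurable_funD; first exact: mabs.
    apply: measurable_funeM.
    by apply: emeasurable_funD; [exact: (mabs _ muh)|exact: mabs].
  - by move=> x _; rewrite -!EFinD lee_fin; exact: ptwise.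
have m2 : measurable_fun setT (fun x : R => (`|u (x + h)%R|%:E + `|u x|%:E)%E).
  by apply: emeasurable_funD; [exact: (mabs _ muh)|exact: mabs].
rewrite ge0_integralD//=; last 4 first.
- by move=> x _; rewrite -!EFinD lee_fin addr_ge0// mulr_ge0// addr_ge0.
- apply: emeasurable_funD; first exact: mabs.
  exact: measurable_funeM.
- by move=> x _; rewrite adde_ge0.
- by apply: emeasurable_funD; exact: mr.
rewrite ge0_integralD//=; last 3 first.
- exact: mabs.
- by move=> x _; rewrite -EFinD lee_fin mulr_ge0// addr_ge0.
- exact: measurable_funeM.
rewrite ge0_integralZl//=; last by move=> x _; rewrite -EFinD lee_fin addr_ge0.
rewrite ge0_integralD//=; [|exact: (mabs _ muh)|exact: mabs].
have -> : (\int[mu]_x `|u (x + h)%R|%:E = \int[mu]_x `|u x|%:E)%E.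
  exact: (ge0_integral_translation h (f := fun x => `|u x|%:E) (mabs _ mu_)).
rewrite ge0_integralD//; [|exact: mr|exact: mr].
rewrite !ir [leLHS]addeC addeA -EFinD.
have -> : 3 * h + 3 * h = 6 * h by ring.
by rewrite (mulrC 2 c) (EFinM c 2) -muleA mule_natl mule2n.
Qed.

End smoothing.

(** * The L1 distance between mixture distribution functions *)

Section mix_cdf_L1.
Context {R : realType}.
Local Notation mu := (@lebesgue_measure R).
Implicit Types (g : probability (measurableTypeR R) R) (a b x : R).

(** The complement of [-a, a] is negligible for [g], so a bound on the kernel is
    only needed at the differences [x - t] with [t] in [-a, a]. *)
Lemma convolution_le_support a g phi x K : g \in prob_itv a ->
  bounded_measurable phi -> (forall z, 0 <= phi z) -> 0 <= K ->
  (forall t, - a <= t <= a -> phi (x - t) <= K) ->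
  convolution g phi x <= K.
Proof.
rewrite inE /prob_itv /= => ga bphi phi0 K0 phiK.
have gN : g (~` `[- a, a]) = 0%E.
  by rewrite probability_setC// ga subee.
rewrite -lee_fin EFin_convolution//.
have <- : (\int[g]_t K%:E = K%:E)%E.
  by rewrite integral_cst//= probability_setT mule1.
apply: ae_ge0_le_integral => //.
- by move=> t _; rewrite lee_fin.
- by have /integrableP[] := integrable_shift g x bphi.
- exists (~` `[- a, a]%classic); split => //.
    exact: measurableC.
  move=> t /=; apply: contra_not; rewrite in_itv/= => ta _.
  by rewrite lee_fin; exact: phiK.
Qed.

Lemma mix_cdf_ge0 b g x : 0 < b -> 0 <= mix_cdf b g x.
Proof.
by move=> b0; rewrite mix_cdfE//; apply: convolution_ge0 => z; exact: laplace_cdf_ge0.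
Qed.

Lemma convolution_cst g (c x : R) : convolution g (fun=> c) x = c.
Proof.
by rewrite /convolution /Rintegral integral_cst//= probability_setT mule1.
Qed.

Lemma mix_cdf_le1 b g x : 0 < b -> mix_cdf b g x <= 1.
Proof.
move=> b0; rewrite mix_cdfE// -[leRHS](convolution_cst g 1 x).
apply: le_convolution.
- exact: bounded_measurable_laplace_cdf.
- by split => //; exists `|1| => z.
- by move=> z; exact: laplace_cdf_le1.
Qed.

Lemma mix_cdf_left_tail a b g x : 0 < b -> g \in prob_itv a -> x < - a ->
  mix_cdf b g x <= expR ((x + a) / b) / 2.
Proof.
move=> b0 ga xa; rewrite mix_cdfE//; apply: (convolution_le_support ga).
- exact: bounded_measurable_laplace_cdf.
- by move=> z; exact: laplace_cdf_ge0.
- by rewrite divr_ge0 ?expR_ge0.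
- move=> t /andP[ta _]; rewrite /laplace_cdf ifT; last by lra.
  by rewrite ler_pM2r// ler_expR ler_pM2r ?invr_gt0//; lra.
Qed.

Lemma mix_cdf_right_tail a b g x : 0 < b -> g \in prob_itv a -> a < x ->
  1 - mix_cdf b g x <= expR (- ((x - a) / b)) / 2.
Proof.
move=> b0 ga ax; rewrite mix_cdfE//.
have bc := bounded_measurable_laplace_cdf b0.
have b1 : bounded_measurable (fun=> 1 : R) by split => //; exists `|1| => z.
rewrite -{1}(convolution_cst g 1 x) -convolutionB//.
apply: (convolution_le_support ga).
- exact: bounded_measurableB.
- by move=> z; rewrite subr_ge0 laplace_cdf_le1.
- by rewrite divr_ge0 ?expR_ge0.
- move=> t /andP[_ ta]; rewrite /laplace_cdf ltNge ifF; last first.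
    by apply/negbTE; rewrite negbK; lra.
  rewrite opprB addrCA subrr addr0.
  by rewrite ler_pM2r// ler_expR lerN2 ler_pM2r ?invr_gt0//; lra.
Qed.

Lemma integrable_mix_pdf b g : 0 < b ->
  mu.-integrable setT (EFin \o mix_pdf b g).
Proof.
move=> b0; apply/integrableP; split.
  by apply/measurable_EFinP; exact: measurable_mix_pdf.
under eq_integral => x _ do rewrite /= ger0_norm ?mix_pdf_ge0//.
by rewrite integral_mix_pdf// ltry.
Qed.

Lemma norm_mix_cdfB_le b g g0 x : 0 < b ->
  (`|mix_cdf b g x - mix_cdf b g0 x|%R%:E <=
   L1norm (fun x => (mix_pdf b g x - mix_pdf b g0 x)%R))%E.
Proof.
move=> b0.
have mD : measurable (`]-oo, x]%classic : set (measurableTypeR R)) by [].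
have im g1 : mu.-integrable `]-oo, x]%classic (EFin \o mix_pdf b g1).
  by apply: (integrableS _ _ _ (integrable_mix_pdf g1 b0)).
have iu : mu.-integrable `]-oo, x]%classic
    (EFin \o (fun x => mix_pdf b g x - mix_pdf b g0 x)).
  rewrite (_ : EFin \o _ = ((EFin \o mix_pdf b g) \- (EFin \o mix_pdf b g0))%E)//.
  exact: integrableB.
rewrite /mix_cdf -RintegralB//.
apply: (@le_trans _ _ (\int[mu]_(t in `]-oo, x]) `|mix_pdf b g t - mix_pdf b g0 t|%R%:E)%E).
  rewrite EFin_normr_Rintegral//.
  by apply: le_abse_integral => //; case/integrableP: iu.
rewrite L1normE; apply: ge0_subset_integral => //.
apply/measurable_EFinP; apply: measurableT_comp => //.
by apply: measurable_funB; exact: measurable_mix_pdf.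
Qed.

(** On [-T, T] the difference is at most [d].  Beyond [T] it is at most
    [expR (- ((x - a) / b)) / 2], and the choice of [T] makes this equal to [b d]
    times a Laplace density centred at [T], of integral [1]; symmetrically for
    [x < - T]. *)
Lemma L1norm_mix_cdf_le a b g g0 d : 0 < a -> 0 < b ->
  g \in prob_itv a -> g0 \in prob_itv a -> 0 < d -> d < 1 ->
  d%:E = L1norm (fun x => mix_pdf b g x - mix_pdf b g0 x) ->
  (L1norm (fun x => (mix_cdf b g x - mix_cdf b g0 x)%R) <=
   (2 * (a + b * ln (1 / d)) * d + 2 * b * d)%:E)%E.
Proof.
move=> a0 b0 ga g0a d0 d1 dE.
set T := a + b * ln (1 / d).
have ld : 0 <= ln (1 / d) by rewrite ln_ge0// ler_pdivlMr// mul1r ltW.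
have aT : a <= T by rewrite lerDl mulr_ge0// ltW.
have bd0 : 0 <= b * d by rewrite mulr_ge0 ?ltW.
have eT y : d * expR ((y + T) / b) = expR ((y + a) / b).
  rewrite (_ : (y + T) / b = (y + a) / b + ln (1 / d)); last first.
    by rewrite /T; field; rewrite gt_eqF.
  by rewrite expRD lnK ?posrE ?divr_gt0//; field; rewrite gt_eqF.
rewrite L1normE.
have U0 x : 0 <= mix_cdf b g x <= 1 by rewrite mix_cdf_ge0// mix_cdf_le1.
have U1 x : 0 <= mix_cdf b g0 x <= 1 by rewrite mix_cdf_ge0// mix_cdf_le1.
have ptwise x : `|mix_cdf b g x - mix_cdf b g0 x| <=
    d * \1_(`[- T, T]%classic) x +
    b * d * (laplace_pdf b (x - T) + laplace_pdf b (x - (- T))).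
  have p1 := laplace_pdf_ge0 (x - T) b0.
  have p2 := laplace_pdf_ge0 (x - (- T)) b0.
  rewrite indicE mem_setE in_itv/=.
  have [xT|xT] := ltP x (- T).
    rewrite mulr0 add0r mulrDr; apply: ler_wpDl; first exact: mulr_ge0.
    rewrite laplace_pdf_nonpos; last by lra.
    have -> : b * d * ((2 * b)^-1 * expR ((x - - T) / b)) =
       expR ((x + a) / b) / 2.
      by rewrite -eT opprK; field; rewrite gt_eqF.
    have t1 := @mix_cdf_left_tail a b g x b0 ga ltac:(lra).
    have t2 := @mix_cdf_left_tail a b g0 x b0 g0a ltac:(lra).
    have := U0 x; have := U1 x.
    rewrite ler_norml; lra.
  have [xT'|xT'] := leP x T.
    rewrite mulr1; apply: ler_wpDr; first by rewrite mulr_ge0// addr_ge0.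
    by rewrite -lee_fin dE; exact: norm_mix_cdfB_le.
  rewrite mulr0 add0r mulrDr; apply: ler_wpDr; first exact: mulr_ge0.
  rewrite laplace_pdf_nonneg; last by lra.
  have -> : b * d * ((2 * b)^-1 * expR (- ((x - T) / b))) =
     expR (- ((x - a) / b)) / 2.
    have := eT (- x).
    rewrite (_ : (- x + T) / b = - ((x - T) / b)); last by ring.
    rewrite (_ : (- x + a) / b = - ((x - a) / b)); last by ring.
    by move=> <-; field; rewrite gt_eqF.
  have t1 := @mix_cdf_right_tail a b g x b0 ga ltac:(lra).
  have t2 := @mix_cdf_right_tail a b g0 x b0 g0a ltac:(lra).
  have := U0 x; have := U1 x.
  rewrite ler_norml; lra.
have ml c : measurable_fun setT (fun x : R => (laplace_pdf b (x - c))%:E).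
  apply/measurable_EFinP; apply: continuous_measurable_fun.
  exact: continuous_laplace_pdf.
have l0 c x : (0 <= (laplace_pdf b (x - c))%:E)%E by rewrite lee_fin laplace_pdf_ge0.
have mi : measurable_fun setT (fun x : R => (\1_(`[- T, T]%classic) x : R)%:E).
  by apply/measurable_EFinP; exact: measurable_indic.
apply: (@le_trans _ _ (\int[mu]_x (d%:E * (\1_(`[- T, T]%classic) x)%:E +
    (b * d)%:E * ((laplace_pdf b (x - T)%R)%:E +
      (laplace_pdf b (x - (- T))%R)%:E)))%E).
  apply: ge0_le_integral => //.
  - apply/measurable_EFinP; apply: measurableT_comp => //.
    by apply: measurable_funB; exact: measurable_mix_cdf.
  - apply: emeasurable_funD; first exact: measurable_funeM.
    by apply: measurable_funeM; apply: emeasurable_funD; exact: ml.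
  - by move=> x _; rewrite -!EFinD lee_fin; exact: ptwise.
rewrite ge0_integralD//=; last 4 first.
- by move=> x _; rewrite -EFinM lee_fin mulr_ge0// ltW.
- exact: measurable_funeM.
- by move=> x _; rewrite mule_ge0// adde_ge0// ?l0.
- by apply: measurable_funeM; apply: emeasurable_funD; exact: ml.
rewrite ge0_integralZl//=; last by rewrite lee_fin ltW.
rewrite ge0_integralZl//=; last 2 first.
- by apply: emeasurable_funD; exact: ml.
- by move=> x _; rewrite adde_ge0// ?l0.
rewrite ge0_integralD//=; [|exact: ml|exact: ml].
rewrite !integral_laplace_pdf// integral_indic//= setIT.
rewrite lebesgue_measure_itv/= lte_fin ifT; last by lra.
rewrite -EFinB -!EFinD lee_fin; lra.
Qed.

End mix_cdf_L1.

(** * The theorem *)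

(** Since [r = h / b] is less than [1 / 2], [ln r <= r - 1 < - 1 / 2]; the second
    bound also uses [2 < b / h]. *)
Lemma log_term_ge (R : realType) (b h : R) : 0 < b -> 0 < h -> h < b / 2 ->
  b ^+ 2 / h <= 2 * (b ^+ 2 * `|ln (h / b)| * h^-1) /\
  b <= b ^+ 2 * `|ln (h / b)| * h^-1.
Proof.
move=> b0 h0 hb.
have hb0 : 0 < h / b by rewrite divr_gt0.
have hb1 : h / b < 2^-1 by rewrite ltr_pdivrMr// mulrC.
have l2 : 2^-1 <= `|ln (h / b)|.
  have := @le_ln1Dx R (h / b - 1) ltac:(lra).
  rewrite addrCA subrr addr0 => l1.
  by rewrite ler0_norm; lra.
have q0 : 0 <= b ^+ 2 / h by rewrite divr_ge0 ?sqr_ge0// ltW.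
have bq : 2 * b <= b ^+ 2 / h.
  rewrite ler_pdivlMr// expr2 (_ : 2 * b * h = b * (2 * h)); last by ring.
  by rewrite ler_pM2l//; lra.
have lq : b ^+ 2 / h * 2^-1 <= b ^+ 2 / h * `|ln (h / b)| by rewrite ler_wpM2l.
rewrite (mulrAC (b ^+ 2)); split; lra.
Qed.

Theorem theorem4p7 (R : realType) :
  exists C : R, 0 < C /\
    forall (a b : R) (g g0 : probability (measurableTypeR R) R) (h d : R),
      0 < a -> 0 < b ->
      g \in prob_itv a -> g0 \in prob_itv a ->
      d%:E = L1norm (fun x => mix_pdf b g x - mix_pdf b g0 x) ->
      0 < h -> h < b / 2 -> 0 < d -> d < 1 ->
      (W1 g g0 <= C%:E *
         (h%:E + L1norm (fun x => (mix_cdf b g x - mix_cdf b g0 x)%R) +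
          (b ^+ 2 * `|ln (h / b)| * h^-1 * d)%:E))%E /\
      (W1 g g0 <=
         (C * (h + (a + b * ln (1 / d)) * d +
               b ^+ 2 * `|ln (h / b)| * h^-1 * d))%:E)%E.
Proof.
(* The term 6 h of L1norm_prob_cdf_le dictates the constant; for the second
   inequality the last term collects 4 L d and 2 b d <= 2 L d. *)
exists 6; split => // a b g g0 h d a0 b0 ga g0a dE h0 hb d0 d1.
have [l1 l2] := log_term_ge b0 h0 hb.
set L := b ^+ 2 * `|ln (h / b)| * h^-1 in l1 l2 *.
have L1 : b ^+ 2 / h * d <= 2 * L * d by rewrite ler_pM2r.
have L2 : b * d <= L * d by rewrite ler_pM2r.
have bd0 : 0 <= b * d by rewrite mulr_ge0 ?ltW.
have Ld0 : 0 <= L * d := le_trans bd0 L2.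
have := le_trans (W1_le_L1norm_prob_cdf g g0)
  (L1norm_prob_cdf_le g g0 b0 h0 (ltW hb)).
rewrite -dE -EFinM => W1le.
set U := L1norm (fun x => (mix_cdf b g x - mix_cdf b g0 x)%R) in W1le *.
have U0 : (0 <= U)%E by rewrite /U L1normE; apply: integral_ge0.
have U6 : (U <= 6%:E * U)%E by rewrite lee_pemull// lee_fin; lra.
split.
  apply: (le_trans W1le).
  rewrite ge0_muleDr; [|by rewrite adde_ge0// lee_fin ltW|by rewrite lee_fin].
  rewrite ge0_muleDr//; last by rewrite lee_fin ltW.
  rewrite -!EFinM; apply: leeD; last by rewrite lee_fin; lra.
  exact: leeD.
have UT : (U <= (2 * (a + b * ln (1 / d)) * d + 2 * b * d)%:E)%E.
  exact: L1norm_mix_cdf_le.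
have T0 : 0 <= (a + b * ln (1 / d)) * d.
  have ld : 0 <= ln (1 / d) by rewrite ln_ge0// ler_pdivlMr// mul1r ltW.
  apply: mulr_ge0; last exact: ltW.
  by apply: addr_ge0; [exact: ltW|apply: mulr_ge0 => //; exact: ltW].
apply: (le_trans W1le).
apply: (@le_trans _ _ ((6 * h)%:E + (2 * (a + b * ln (1 / d)) * d + 2 * b * d)%:E
    + (2 * (b ^+ 2 / h) * d)%:E)%E).
  by rewrite leeD2r// leeD2l.
by rewrite -!EFinD lee_fin; lra.
Qed.
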